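(* Let $D$ be a principal ideal domain and let $A$ be an $n\times n$ matrix over the polynomial ring $D[x]$. Suppose $A$ is not nilpotent, and let $l=\min\{k\in\mathbb{N} : \operatorname{rank}(A^k)=\operatorname{rank}(A^{k+1})\}$. Then there is an algebraic strong shift equivalence of lag $l$ over $D[x]$ from $A$ to a nonsingular square matrix over $D[x]$. In particular, every non-nilpotent square matrix over $D[x]$ is algebraically strong shift equivalent over $D[x]$ to a nonsingular matrix.
   Context: Rings are commutative. The rank of a matrix over the domain $D[x]$ is the largest order of a nonzero minor (equivalently, its rank over the fraction field); a square matrix is nonsingular if its determinant is nonzero. Two square matrices $A,B$ (possibly of different orders) over a ring $R$ are elementarily strong shift equivalent over $R$ if there exist (rectangular) matrices $U,V$ over $R$ with $A=UV$ and $B=VU$. $A$ and $B$ are algebraically strong shift equivalent over $R$ of lag $l$ if there is a chain $A=A_0,A_1,\dots,A_l=B$ of square matrices over $R$ such that $A_{i-1}$ and $A_i$ are elementarily strong shift equivalent over $R$ for each $i=1,\dots,l$. *)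

(* Defs.v *)
From HB Require Import structures.
From mathcomp Require Import all_boot all_order all_algebra.
From mathcomp Require Import fraction.
Set Implicit Arguments. Unset Strict Implicit. Unset Printing Implicit Defensive.
Import GRing.Theory.
Local Open Scope ring_scope.

Definition is_ideal (R : comNzRingType) (I : R -> Prop) : Prop :=
  I 0 /\ (forall x y, I x -> I y -> I (x - y)) /\ (forall a x, I x -> I (a * x)).

Definition is_PID (D : idomainType) : Prop :=
  forall I : D -> Prop, is_ideal I -> exists g : D, forall x, I x <-> exists c, x = c * g.

Definition prank (D : idomainType) (m n : nat) (A : 'M[{poly D}]_(m, n)) : nat :=
  \rank (map_mx (@tofrac _) A).

Definition nilpotent_mx (R : pzRingType) (n : nat) (A : 'M[R]_n) : Prop :=
  exists k, A ^+ k = 0.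

Definition esse (R : pzRingType) (m n : nat) (A : 'M[R]_m) (B : 'M[R]_n) : Prop :=
  exists (U : 'M[R]_(m, n)) (V : 'M[R]_(n, m)), A = U *m V /\ B = V *m U.

Inductive sse_lag (R : pzRingType) : forall m n : nat, 'M[R]_m -> 'M[R]_n -> nat -> Prop :=
  | sse_lag0 m (A : 'M[R]_m) : sse_lag A A 0
  | sse_lagS m k n (A : 'M[R]_m) (B : 'M[R]_k) (C : 'M[R]_n) l :
      esse A B -> sse_lag B C l -> sse_lag A C l.+1.

Definition sse (R : pzRingType) (m n : nat) (A : 'M[R]_m) (B : 'M[R]_n) : Prop :=
  exists l, sse_lag A B l.

(* Main.v *)
(** The heart of the matter is a rank factorization over [D[x]]: a matrix [A] of
    rank [r] is a product [U V] with inner dimension [r]. Then [B = V U] is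
    elementarily strong shift equivalent to [A], of order [rank A], and
    [rank (B ^ k) = rank (A ^ k.+1)]; iterating [l] times gives a nonsingular matrix.

    For the factorization, row operations on [V], with the inverse column operations
    on [U], preserve [U V]. Euclidean division in [K[x]], [K = Frac D], carried
    out without denominators, removes one inner dimension whenever [U] or [V] has a
    kernel; this yields [d A = U V] with inner dimension [r] and [d] a nonzero
    element of [D]. The irreducible factors [p] of [d] are then cancelled one by
    one: [U V] vanishes modulo [p] and [(D/p)[x]] is Euclidean, so after such
    operations each column of [U] or the corresponding row of [V] is divisible by
    [p], and [p] can be divided out without changing the inner dimension. *)

Require Import Defs.
From HB Require Import structures.
From mathcomp Require Import all_boot all_order all_algebra.
From mathcomp Require Import fraction.
From mathcomp Require Import ring zify.
From Stdlib Require Import ClassicalEpsilon.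
Set Implicit Arguments. Unset Strict Implicit. Unset Printing Implicit Defensive.
Import GRing.Theory.
Local Open Scope ring_scope.

(** * Divisibility by constants and division modulo [p] in [D[x]] *)

Definition divides (R : comNzRingType) (a b : R) : Prop := exists c, b = c * a.

Lemma dividesB (R : comNzRingType) (a b c : R) :
  divides a b -> divides a c -> divides a (b - c).
Proof. by move=> [x ->] [y ->]; exists (x - y); rewrite mulrBl. Qed.

Lemma dividesD (R : comNzRingType) (a b c : R) :
  divides a b -> divides a c -> divides a (b + c).
Proof. by move=> [x ->] [y ->]; exists (x + y); rewrite mulrDl. Qed.

Lemma divides_mull (R : comNzRingType) (a b c : R) :
  divides a b -> divides a (c * b).
Proof. by move=> [x ->]; exists (c * x); rewrite mulrA. Qed.

Lemma divides_sum (R : comNzRingType) (I : finType) (P : pred I) (F : I -> R) a :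
  (forall i, P i -> divides a (F i)) -> divides a (\sum_(i | P i) F i).
Proof.
move=> aF; elim/big_ind: _ => //; last exact: dividesD.
by exists 0; rewrite mul0r.
Qed.

Lemma divides_polyC (D : idomainType) (p c : D) (f : {poly D}) :
  divides p c -> divides p%:P (c *: f).
Proof.
by move=> [x ->]; exists (x *: f); rewrite -mul_polyC polyCM -mul_polyC; ring.
Qed.

Lemma divides_polyC_coef (D : idomainType) (p : D) (f : {poly D}) i :
  divides p%:P f -> divides p f`_i.
Proof. by move=> [g ->]; exists g`_i; rewrite coefMC. Qed.

(* [scale] collects the scalars by which products may be multiplied along the
   reduction: all nonzero ones when [p = 0], only [1] when [p] is irreducible. *)
Record reduction_modulus (D : idomainType) (p : D) (scale : D -> Prop) : Prop := {
  scale1 : scale 1;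
  scaleM : forall a b, scale a -> scale b -> scale (a * b);
  scale_ndvd : forall e, scale e -> ~ divides p e;
  modulus_prime : forall a b, divides p (a * b) -> divides p a \/ divides p b;
  modulus_quo : forall a b, ~ divides p b ->
    exists e q, scale e /\ divides p (e * a - q * b) }.

Lemma size_sub_lead (D : idomainType) (f : {poly D}) :
  f != 0 -> (size (f - lead_coef f *: 'X^((size f).-1))%R < size f)%N.
Proof.
rewrite -size_poly_gt0 => sf; rewrite -(prednK sf) ltnS.
apply/leq_sizeP => i hi; rewrite coefB coefZ coefXn.
have [->|ne] := eqVneq i (size f).-1; first by rewrite mulr1 lead_coefE subrr.
by rewrite mulr0 subr0 nth_default // -(prednK sf) ltn_neqAle eq_sym ne.
Qed.

(** Gauss's argument: [p] divides the product of the leading coefficients, hence one of them, and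
    removing that leading term keeps the product divisible by [p]. *)
Lemma polyC_prime (D : idomainType) (p : D) scale (hp : reduction_modulus p scale)
    (f g : {poly D}) :
  divides p%:P (f * g) -> divides p%:P f \/ divides p%:P g.
Proof.
have [N] := ubnP (size f + size g)%N; elim: N f g => // N IH f g hN hfg.
have [->|f0] := eqVneq f 0; first by left; exists 0; rewrite mul0r.
have [->|g0] := eqVneq g 0; first by right; exists 0; rewrite mul0r.
have : divides p (lead_coef f * lead_coef g).
  by rewrite -lead_coefM; apply: divides_polyC_coef.
case/(modulus_prime hp) => hl.
- have hf := divides_polyC 'X^((size f).-1) hl.
  have := size_sub_lead f0; set f' := f - _ => sf.
  have [||h|h] := IH f' g; [by lia| | |by right].
    by rewrite mulrBl; apply: dividesB => //; rewrite mulrC; apply: divides_mull.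
  by left; have -> : f = f' + lead_coef f *: 'X^((size f).-1)
    by [rewrite subrK]; apply: dividesD.
- have hg := divides_polyC 'X^((size g).-1) hl.
  have := size_sub_lead g0; set g' := g - _ => sg.
  have [||h|h] := IH f g'; [by lia| |by left|].
    by rewrite mulrBr; apply: dividesB => //; apply: divides_mull.
  by right; have -> : g = g' + lead_coef g *: 'X^((size g).-1)
    by [rewrite subrK]; apply: dividesD.
Qed.

(** Fraction-free Euclidean algorithm: a 2 by 2 matrix with determinant in [scale] turns [(a, b)]
    into a pair whose second entry vanishes modulo [p]. *)
Lemma bezout_mod (D : idomainType) (p : D) scale (hp : reduction_modulus p scale)
    (a b : {poly D}) :
  exists s t x y e, [/\ scale e, s * y - t * x = e%:P &
    divides p%:P (x * a + y * b)].
Proof.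
have [N] := ubnP (size a + size b)%N; elim: N a b => // N IH a b hN.
wlog hab : a b hN / (size b <= size a)%N.
  move=> W; case: (leqP (size b) (size a)) => [|/ltnW] h; first exact: W.
  have [||s [t [x [y [e [? hd ?]]]]]] := W b a; [by lia|done|].
  exists (- t), (- s), y, x, e; split; [done|by rewrite -hd; ring|by rewrite addrC].
have [->|b0] := eqVneq b 0.
  exists 1, 0, 0, 1, 1; split; [exact: scale1 hp|by rewrite polyC1; ring|].
  by exists 0; ring.
have a0 : a != 0 by rewrite -size_poly_gt0 (leq_trans _ hab) // size_poly_gt0.
have sa := size_sub_lead a0; have sb := size_sub_lead b0.
case: (classic (divides p (lead_coef b))) => [hl|nb].
  have hb := divides_polyC 'X^((size b).-1) hl.
  have [|s [t [x [y [e [? ? h]]]]]] :=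
    IH a (b - lead_coef b *: 'X^((size b).-1)); first by lia.
  exists s, t, x, y, e; split=> //.
  have -> : x * a + y * b = x * a + y * (b - lead_coef b *: 'X^((size b).-1))
    + y * (lead_coef b *: 'X^((size b).-1)) by ring.
  by apply: dividesD => //; apply: divides_mull.
have [e [q [he hr]]] := modulus_quo hp (lead_coef a) nb.
pose r := e * lead_coef a - q * lead_coef b.
pose j := (size a - size b)%N.
(* Pseudo-remainder stripped of its top term, whose coefficient [r] is divisible by [p]: the size
   drops and the class modulo [p] is unchanged. *)
pose a' := e%:P * a - q%:P * 'X^j * b - r *: 'X^((size a).-1).
have ha' : (size a' < size a)%N.
  move: a0; rewrite -size_poly_gt0 => a0; rewrite -(prednK a0) ltnS.
  apply/leq_sizeP => i hi.
  rewrite !coefB coefZ coefXn coefCM -mulrA coefCM coefXnM.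
  have [->|ne] := eqVneq i (size a).-1.
    have sb0 : (0 < size b)%N by rewrite size_poly_gt0.
    have -> : ((size a).-1 < j)%N = false by rewrite /j; lia.
    have -> : ((size a).-1 - j)%N = (size b).-1 by rewrite /j; lia.
    by rewrite -!lead_coefE mulr1 subrr.
  have hi' : (size a <= i)%N by rewrite -(prednK a0) ltn_neqAle eq_sym ne.
  have hb' : (size b <= i - j)%N by rewrite /j; lia.
  rewrite (nth_default _ hi') (nth_default _ hb').
  by case: ifP => _; rewrite !mulr0 !subr0.
have [|s [t [x [y [e' [he' hd h]]]]]] := IH a' b.
  by rewrite ltnS in hN; apply: leq_trans hN; rewrite ltn_add2r.
exists (s * e%:P), (t - s * q%:P * 'X^j), (x * e%:P), (y - x * q%:P * 'X^j), (e' * e).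
split; first exact: (scaleM hp).
  by rewrite polyCM -hd; ring.
have -> : x * e%:P * a + (y - x * q%:P * 'X^j) * b =
  x * a' + y * b + x * (r *: 'X^((size a).-1)) by rewrite /a'; ring.
by apply: dividesD => //; apply/divides_mull/divides_polyC.
Qed.

(** * Row and column operations on a product *)

(** Rows [j], [k] of [V] are hit by a 2 by 2 matrix, columns [j], [k] of [U] by its adjugate, so [e]
    is never inverted. *)
Lemma mulmx_row_pair_op (R : comNzRingType) m r n (U : 'M[R]_(m, r))
    (V : 'M[R]_(r, n)) (j k : 'I_r) (s t x y e : R) :
  j != k -> s * y - t * x = e ->
  exists (U' : 'M[R]_(m, r)) (V' : 'M[R]_(r, n)),
    [/\ U' *m V' = e *: (U *m V),
        forall i l, l != j -> l != k -> U' i l = e * U i l,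
        forall l c, l != j -> l != k -> V' l c = V l c,
        forall c, V' j c = s * V j c + t * V k c &
        forall c, V' k c = x * V j c + y * V k c].
Proof.
move=> jk he.
exists (\matrix_(i, l) if l == j then y * U i j - x * U i k
                       else if l == k then s * U i k - t * U i j
                       else e * U i l).
exists (\matrix_(l, c) if l == j then s * V j c + t * V k c
                       else if l == k then x * V j c + y * V k c
                       else V l c).
have kj : (k == j) = false by rewrite eq_sym (negbTE jk).
split=> [|i l /negbTE lj /negbTE lk|l c /negbTE lj /negbTE lk|c|c];
  rewrite ?mxE ?lj ?lk ?eqxx ?kj //.
apply/matrixP=> i c; rewrite !mxE.
rewrite (bigD1 j) //= (bigD1 k) /=; last by rewrite kj.
rewrite [in RHS](bigD1 j) //= [in RHS](bigD1 k) /=; last by rewrite kj.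
rewrite !mxE !eqxx kj !mulrDr big_distrr /= !addrA; congr (_ + _).
  by rewrite -he; ring.
apply: eq_bigr => l /andP[/negbTE lj /negbTE lk].
by rewrite !mxE lj lk mulrA.
Qed.

(** Elimination with pivot row [j], one row of [ks] at a time. The last clause keeps track of
    columns of [U] already divisible by [p]. *)
Lemma clear_column (D : idomainType) (p : D) scale
    (hp : reduction_modulus p scale) m r n (U : 'M[{poly D}]_(m, r))
    (V : 'M[{poly D}]_(r, n)) (c : 'I_n) (j : 'I_r) (ks : seq 'I_r) :
  ~ divides p%:P (V j c) -> j \notin ks ->
  exists (U' : 'M[{poly D}]_(m, r)) (V' : 'M[{poly D}]_(r, n)) e,
    [/\ scale e, U' *m V' = e%:P *: (U *m V), ~ divides p%:P (V' j c),
        forall k, k \in ks -> divides p%:P (V' k c) &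
        forall l, l != j -> l \notin ks -> (forall i, divides p%:P (U i l)) ->
          forall i, divides p%:P (U' i l)].
Proof.
move=> nj; elim: ks => [_|k ks IH].
  by exists U, V, 1; split=> //; [exact: scale1 hp | rewrite scale1r].
rewrite inE negb_or => /andP[jk jks].
have [U1 [V1 [e1 [he1 hUV1 nj1 hks1 hU1]]]] := IH jks.
have [s [t [x [y [e [he hd hdiv]]]]]] := bezout_mod hp (V1 j c) (V1 k c).
have [U2 [V2 [hUV2 hU2 hV2 hV2j hV2k]]] := mulmx_row_pair_op U1 V1 jk hd.
exists U2, V2, (e * e1); split.
- exact: (scaleM hp).
- by rewrite hUV2 hUV1 scalerA polyCM.
(* The adjugate recovers [e] times the old pivot from the two new entries, so a new pivot divisible
   by [p] would force [p] to divide [e]. *)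
- move=> hj.
  have : divides p%:P (e%:P * V1 j c).
    have -> : e%:P * V1 j c = y * V2 j c - t * V2 k c.
      by rewrite hV2j hV2k -hd; ring.
    by apply: dividesB; apply: divides_mull => //; rewrite hV2k.
  case/(polyC_prime hp) => // /divides_polyC_coef => /(_ 0).
  by rewrite coefC eqxx; apply: (scale_ndvd hp).
- move=> l; have [->|lk] := eqVneq l k; first by rewrite hV2k.
  rewrite inE (negbTE lk) /= => lks.
  by rewrite hV2 //; [exact: hks1 | apply: contraNneq jks => <-].
move=> l lj; rewrite inE negb_or => /andP[lk lks] hl i.
by rewrite hU2 //; apply/divides_mull/hU1.
Qed.

(** * Irreducible and zero moduli, and cancellation of scalars *)

(** [D/p] is a field: a generator of the ideal [(p, a)] divides [p], so it is a unit or an associate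
    of [p]; in the latter case [p] divides [a]. *)
Lemma irreducible_modulus (D : idomainType) (hD : is_PID D) (p : D) :
  p \isn't a GRing.unit ->
  (forall a b, p = a * b -> a \is a GRing.unit \/ b \is a GRing.unit) ->
  reduction_modulus p (fun e => e = 1).
Proof.
move=> pu irr.
have inv_mod a : ~ divides p a -> exists b, divides p (1 - b * a).
  move=> npa.
  have [|g hg] := hD (fun z => exists u v, z = u * p + v * a).
    split; first by exists 0, 0; ring.
    split; first by move=> _ _ [u [v ->]] [u' [v' ->]]; exists (u - u'), (v - v'); ring.
    by move=> b _ [u [v ->]]; exists (b * u), (b * v); ring.
  have [c hc] : exists c, p = c * g by apply/hg; exists 1, 0; ring.
  have [c' hc'] : exists c, a = c * g by apply/hg; exists 0, 1; ring.
  case: (irr _ _ hc) => [cu|gu].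
    by case: npa; exists (c' / c); rewrite hc mulrA divrK.
  have [u [v huv]] : exists u v, 1 = u * p + v * a.
    by apply/hg; exists g^-1; rewrite mulVr.
  by exists v, u; rewrite huv; ring.
split=> // [a b -> ->|_ -> [c hc]|a b hab|a b].
- by rewrite mulr1.
- case/negP: pu; apply/unitrPr; exists c.
  by rewrite hc mulrC.
- case: (classic (divides p a)) => [|/inv_mod [x hx]]; first by left.
  right; have -> : b = b * (1 - x * a) + x * (a * b) by ring.
  by apply: dividesD; apply: divides_mull.
- move=> /inv_mod [x hx]; exists 1, (a * x); split=> //.
  have -> : 1 * a - a * x * b = a * (1 - x * b) by ring.
  exact: divides_mull.
Qed.

Lemma zero_modulus (D : idomainType) : reduction_modulus (0 : D) (fun e => e != 0).
Proof.
have d0 (a : D) : divides 0 a -> a = 0 by move=> [c ->]; rewrite mulr0.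
split=> [|a b a0 b0|e /eqP e0 /d0 //|a b /d0 /eqP|a b nb].
- exact: oner_neq0.
- by rewrite mulf_neq0.
- by rewrite mulf_eq0 => /orP[] /eqP ->; [left|right]; exists 0; rewrite mulr0.
(* Division modulo [0] is cross-multiplication, with the nonzero scalar [b]. *)
- exists b, a; split; last by exists 0; ring.
  by apply/eqP => b0; apply: nb; exists 0; rewrite mulr0.
Qed.

(* Columns of [U] outside [T] are already divisible by [p]; a row of [V] in [T]
   not divisible by [p] allows one index to be removed from [T]. *)
Lemma mulmx_divide (D : idomainType) (p : D)
    (hp : reduction_modulus p (fun e => e = 1)) m r n
    (U : 'M[{poly D}]_(m, r)) (V : 'M[{poly D}]_(r, n)) (T : {set 'I_r}) :
  (forall i c, divides p%:P ((U *m V) i c)) ->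
  (forall l, l \notin T -> forall i, divides p%:P (U i l)) ->
  exists (U' : 'M[{poly D}]_(m, r)) (V' : 'M[{poly D}]_(r, n)),
    U *m V = p%:P *: (U' *m V').
Proof.
have [N] := ubnP #|T|; elim: N U V T => // N IH U V T hN hUV hU.
case: (classic (forall l c, l \in T -> divides p%:P (V l c))) => [hV|nV].
  (* Each summand of the product gives up one factor [p]: from [V] for indices in [T], from [U]
     otherwise. *)
  have /fin_all_exists [u hu] (x : 'I_m * 'I_r) :
      exists g, U x.1 x.2 = g * (if x.2 \in T then 1 else p%:P).
    by case: ifP => [_|/negbT /hU]; [exists (U x.1 x.2); rewrite mulr1|exact].
  have /fin_all_exists [v hv] (x : 'I_r * 'I_n) :
      exists g, V x.1 x.2 = g * (if x.1 \in T then p%:P else 1).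
    by case: ifP => [/hV|_]; [exact|exists (V x.1 x.2); rewrite mulr1].
  exists (\matrix_(i, l) u (i, l)), (\matrix_(l, c) v (l, c)).
  apply/matrixP=> i c; rewrite !mxE big_distrr; apply: eq_bigr => l _ /=.
  rewrite !mxE (hu (i, l)) (hv (l, c)) /=.
  by case: ifP => _; ring.
have {nV} [j [c [jT nj]]] : exists j c, j \in T /\ ~ divides p%:P (V j c).
  apply: NNPP => h; apply: nV => l c lT; apply: NNPP => nl; apply: h.
  by exists l, c.
have [|U1 [V1 [e [-> hUV1 nj1 hks hU1]]]] :=
  clear_column hp U (ks := enum (T :\ j)) nj.
  by rewrite mem_enum !inE eqxx.
rewrite polyC1 scale1r in hUV1; rewrite -hUV1.
apply: (IH _ _ (T :\ j)); first by rewrite (cardsD1 j T) jT in hN.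
  by rewrite hUV1.
move=> l lT i; have [->|lj] := eqVneq l j; last first.
  apply: hU1 => //; first by rewrite mem_enum.
  by apply: hU; apply: contraNN lT => lT; rewrite !inE lj.
have U1out k : k \notin T -> divides p%:P (U1 i k).
  move=> kT; apply: hU1; [by apply: contraNneq kT => ->| |exact: hU].
  by rewrite mem_enum !inE (negbTE kT) andbF.
(* All other summands of entry [(i, c)] are divisible by [p], hence so is this one; as [p] does not
   divide the pivot, it divides [U1 i j]. *)
have : divides p%:P (U1 i j * V1 j c).
  have -> : U1 i j * V1 j c =
      (U *m V) i c - \sum_(k | k != j) U1 i k * V1 k c.
    by rewrite -hUV1 mxE (bigD1 j) //= addrK.
  apply: dividesB => //; apply: divides_sum => k kj.
  have [kT|/U1out] := boolP (k \in T).
    by apply/divides_mull/hks; rewrite mem_enum !inE kj.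
  by rewrite mulrC; apply: divides_mull.
by case/(polyC_prime hp).
Qed.

Lemma mulmx_cancel_irreducible (D : idomainType) (p : D)
    (hp : reduction_modulus p (fun e => e = 1)) (p0 : p != 0) m r n
    (A : 'M[{poly D}]_(m, n)) (U : 'M[{poly D}]_(m, r)) (V : 'M[{poly D}]_(r, n)) :
  p%:P *: A = U *m V ->
  exists (U' : 'M[{poly D}]_(m, r)) (V' : 'M[{poly D}]_(r, n)), A = U' *m V'.
Proof.
move=> hA.
have [||U' [V' h]] := mulmx_divide hp (U := U) (V := V) (T := [set: 'I_r]).
- by move=> i c; rewrite -hA mxE; exists (A i c); rewrite mulrC.
- by move=> l; rewrite inE.
exists U', V'; apply/matrixP=> i c.
have : (p%:P *: A) i c = (p%:P *: (U' *m V')) i c by rewrite hA h.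
by rewrite mxE [RHS]mxE => /mulfI -> //; rewrite polyC_eq0.
Qed.

(** Ascending chain condition: along an infinite chain of proper divisors, the multiples of the
    terms form an ideal whose generator is already a multiple of some term. *)
Lemma proper_divisor_wf (D : idomainType) (hD : is_PID D) :
  well_founded (fun a d : D =>
    d != 0 /\ exists b, b \isn't a GRing.unit /\ d = b * a).
Proof.
set R := fun a d => _; move=> d0; apply: NNPP => nd0.
pose bad := {d | ~ Acc R d}.
have step (d : bad) : exists d' : bad, R (sval d') (sval d).
  case: d => d nd; apply: NNPP => h; apply: (nd); split=> a ha.
  by apply: NNPP => na; apply: h; exists (exist _ a na).
pose next d : bad := sval (constructive_indefinite_description _ (step d)).
have nextP d : R (sval (next d)) (sval d).
  by rewrite /next; case: constructive_indefinite_description.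
pose f k := sval (iter k next (exist _ d0 nd0)).
have fS k : R (f k.+1) (f k) by apply: nextP.
have fD k l : divides (f (k + l)%N) (f k).
  elim: l => [|l [c ->]]; first by rewrite addn0; exists 1; rewrite mul1r.
  rewrite addnS; have [_ [b [_ ->]]] := fS (k + l)%N.
  by exists (c * b); rewrite mulrA.
have [|g hg] := hD (fun x => exists k, divides (f k) x).
  split; first by exists 0%N, 0; rewrite mul0r.
  split; last by move=> a x [k hx]; exists k; apply: divides_mull.
  move=> x y [k [a ->]] [l [b ->]]; exists (k + l)%N.
  by apply: dividesB; apply: divides_mull; rewrite // addnC.
have [k [c hc]] : exists k, divides (f k) g by apply/hg; exists 1; rewrite mul1r.
have [c' hc'] : exists c, f k.+1 = c * g by apply/hg; exists k.+1, 1; rewrite mul1r.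
have [fk0 [b [/negP bu hb]]] := fS k.
(* Here [f k = b * f k.+1 = b * c' * g = b * c' * c * f k], and [f k] cancels. *)
apply: bu; apply/unitrPr; exists (c' * c).
apply: (mulIf fk0); rewrite mul1r {2}hb hc' hc; ring.
Qed.

(** Induction on proper divisors replaces a factorization into irreducibles: a unit is absorbed into
    [U], and a reducible [d] is cancelled in two stages. *)
Lemma mulmx_cancel_scalar (D : idomainType) (hD : is_PID D) (d : D) m r n
    (A : 'M[{poly D}]_(m, n)) (U : 'M[{poly D}]_(m, r)) (V : 'M[{poly D}]_(r, n)) :
  d != 0 -> d%:P *: A = U *m V ->
  exists (U' : 'M[{poly D}]_(m, r)) (V' : 'M[{poly D}]_(r, n)), A = U' *m V'.
Proof.
elim/(well_founded_ind (proper_divisor_wf hD)): d A U V => d IH A U V d0 hA.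
have [du|dnu] := boolP (d \is a GRing.unit).
  exists ((d^-1)%:P *: U), V.
  by rewrite -scalemxAl -hA scalerA -polyCM mulVr // polyC1 scale1r.
case: (classic (exists a b, [/\ a \isn't a GRing.unit, b \isn't a GRing.unit
    & d = a * b])) => [[a [b [au bu dab]]]|irr].
  have [a0 b0] : a != 0 /\ b != 0.
    by move: d0; rewrite dab mulf_eq0 negb_or => /andP.
  have [|||U' [V' h]] := IH a _ (b%:P *: A) U V.
  - by split=> //; exists b; rewrite mulrC.
  - by [].
  - by rewrite scalerA -polyCM -dab.
  by apply: (IH b _ A U' V') => //; split=> //; exists a.
have := mulmx_cancel_irreducible _ d0 hA; apply.
apply: irreducible_modulus => // a b dab.
case: (boolP (a \is a GRing.unit)) => au; [by left|right].
by apply/negPn/negP => bu; apply: irr; exists a, b.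
Qed.

(** * Denominators and kernels over the fraction field *)

Lemma fraction_numden (R : idomainType) (x : {fraction R}) :
  exists a b : R, b != 0 /\ tofrac b * x = tofrac a.
Proof.
elim/quotW: x => x; exists \n_x, \d_x; split; first exact: denom_ratioP.
unlock tofrac; rewrite -[LHS]FracField.pi_mul; apply/eqmodP/eqP.
rewrite /FracField.mulf !numden_Ratio ?mul1r ?oner_neq0 ?denom_ratioP //; ring.
Qed.

Lemma rV_clear_denominators (R : idomainType) n (v : 'rV[{fraction R}]_n) :
  exists (b : R) (w : 'rV[R]_n), b != 0 /\ tofrac b *: v = map_mx (@tofrac R) w.
Proof.
have /fin_all_exists [a /fin_all_exists [b hab]] (i : 'I_n) :=
  fraction_numden (v 0 i).
exists (\prod_i b i), (\row_i (a i * \prod_(j | j != i) b j)); split.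
  by apply/prodf_neq0 => i _; case: (hab i).
apply/rowP=> i; rewrite !mxE (bigD1 i) //= !tofracM -(proj2 (hab i)); ring.
Qed.

Lemma row_kernel_of_rank (R : idomainType) m n (A : 'M[R]_(m, n)) :
  ~~ row_free (map_mx (@tofrac R) A) -> exists2 w : 'rV[R]_m, w != 0 & w *m A = 0.
Proof.
rewrite -kermx_eq0 => /rowV0Pn [v /sub_kermxP hv v0].
have [b [w [b0 hw]]] := rV_clear_denominators v.
exists w.
  apply: contraNneq v0 => w0; move/eqP: hw; rewrite w0 map_mx0 scaler_eq0.
  by rewrite tofrac_eq0 (negbTE b0).
apply/matrixP => i j; rewrite [RHS]mxE; apply/eqP; rewrite -tofrac_eq0.
have /matrixP/(_ i j) : map_mx (@tofrac R) (w *m A) = 0.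
  by rewrite map_mxM -hw -scalemxAl hv scaler0.
by rewrite mxE [RHS]mxE => ->.
Qed.

(** * Rank factorization *)

Lemma mulmx_drop_kernel (D : idomainType) m r n (U : 'M[{poly D}]_(m, r.+1))
    (V : 'M[{poly D}]_(r.+1, n)) (w : 'cV[{poly D}]_r.+1) :
  w != 0 -> U *m w = 0 ->
  exists (d : D) (U' : 'M[{poly D}]_(m, r)) (V' : 'M[{poly D}]_(r, n)),
    d != 0 /\ d%:P *: (U *m V) = U' *m V'.
Proof.
move=> /cV0Pn [j wj] Uw.
have [||U1 [V1 [e [e0 hUV nj hks _]]]] := clear_column (zero_modulus D) U
  (V := row_mx V w) (c := rshift n ord0) (j := j) (ks := enum (~: [set j])).
- by rewrite row_mxEr => -[c hc]; rewrite hc polyC0 mulr0 eqxx in wj.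
- by rewrite mem_enum !inE eqxx.
have hk k : k != j -> V1 k (rshift n ord0) = 0.
  move=> kj; have [|c ->] := hks k; first by rewrite mem_enum !inE.
  by rewrite polyC0 mulr0.
have U1j i : U1 i j = 0.
  have /matrixP/(_ i (rshift n ord0)) := hUV.
  rewrite mul_mx_row Uw scale_row_mx scaler0 row_mxEr [RHS]mxE mxE (bigD1 j) //=.
  rewrite big1 ?addr0 => [|k /hk ->]; last exact: mulr0.
  move=> /eqP; rewrite mulf_eq0 => /orP[/eqP //|/eqP V0].
  by case: nj; exists 0; rewrite V0 mul0r.
exists e, (col' j U1), (row' j (lsubmx V1)); split=> //.
apply/matrixP=> i c; have /matrixP/(_ i (lshift 1 c)) := hUV.
rewrite mul_mx_row scale_row_mx row_mxEl => <-.
rewrite !mxE (bigD1_ord j) //= U1j mul0r add0r.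
by apply: eq_bigr => k _; rewrite !mxE.
Qed.

Lemma rank_factorization_upto (D : idomainType) r m n (A : 'M[{poly D}]_(m, n))
    (U : 'M[{poly D}]_(m, r)) (V : 'M[{poly D}]_(r, n)) (d : D) :
  d != 0 -> d%:P *: A = U *m V ->
  exists (d' : D) (U' : 'M[{poly D}]_(m, prank A))
    (V' : 'M[{poly D}]_(prank A, n)), d' != 0 /\ d'%:P *: A = U' *m V'.
Proof.
pose f m n := @map_mx _ _ (@tofrac {poly D}) m n.
elim: r U V d => [|r IH] U V d d0 hA; have rA : prank A = \rank (f _ _ U *m f _ _ V)
  by rewrite -?map_mxM -hA map_mxZ mxrank_scale_nz // tofrac_eq0 polyC_eq0.
  have -> : prank A = 0%N.
    apply/eqP; rewrite -leqn0 rA.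
    exact: leq_trans (mxrankM_maxl _ _) (rank_leq_col _).
  by exists d, U, V.
(* A left kernel vector of [V] is handled by transposing the product. *)
have [Vfree|] := boolP (row_free (f _ _ V)); last first.
  case/row_kernel_of_rank => w w0 wV.
  have [||d1 [V1 [U1 [d10 h]]]] := mulmx_drop_kernel (U := V^T) U^T (w := w^T).
  - by apply: contra_neq w0 => /(congr1 trmx); rewrite trmxK trmx0.
  - by rewrite -trmx_mul wV trmx0.
  apply: (IH U1^T V1^T (d1 * d)); first by rewrite mulf_neq0.
  by rewrite -trmx_mul -h linearZ /= trmx_mul !trmxK polyCM -scalerA hA.
rewrite mxrankMfree // in rA.
have [Ufree|] := boolP (row_free (f _ _ U^T)); last first.
  case/row_kernel_of_rank => w w0 wU.
  have [||d1 [U1 [V1 [d10 h]]]] := mulmx_drop_kernel (U := U) V (w := w^T).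
  - by apply: contra_neq w0 => /(congr1 trmx); rewrite trmxK trmx0.
  - by rewrite -[U]trmxK -trmx_mul wU trmx0.
  apply: (IH U1 V1 (d1 * d)); first by rewrite mulf_neq0.
  by rewrite -h polyCM -scalerA hA.
(* Both factors now have full rank over the fraction field, so the inner dimension is the rank. *)
have -> : prank A = r.+1 by rewrite rA -mxrank_tr /f map_trmx; apply/eqP.
by exists d, U, V.
Qed.

Lemma rank_factorization (D : idomainType) (hD : is_PID D) m n
    (A : 'M[{poly D}]_(m, n)) :
  exists (U : 'M[{poly D}]_(m, prank A)) (V : 'M[{poly D}]_(prank A, n)),
    A = U *m V.
Proof.
have [|d [U [V [d0 h]]]] := @rank_factorization_upto D _ m n A A 1%:M 1 (oner_neq0 _).
  by rewrite mulmx1 polyC1 scale1r.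
by have := mulmx_cancel_scalar hD d0 h.
Qed.

(** * Ranks of powers and strong shift equivalence *)

Lemma exprmx_mulC (R : pzRingType) n r (U : 'M[R]_(n, r)) (V : 'M[R]_(r, n)) k :
  (U *m V) ^+ k.+1 = U *m (V *m U) ^+ k *m V.
Proof.
elim: k => [|k IH]; first by rewrite expr1 expr0 mulmx1.
by rewrite exprSr IH [in RHS]exprSr -!mulmxE !mulmxA.
Qed.

(** A product whose rank equals its inner dimension has a left factor of full column rank and a
    right factor of full row rank. *)
Lemma prank_mul_inner (D : idomainType) n r (U : 'M[{poly D}]_(n, r))
    (V : 'M[{poly D}]_(r, n)) (M : 'M[{poly D}]_r) :
  prank (U *m V) = r -> prank (U *m M *m V) = prank M.
Proof.
rewrite /prank !map_mxM => hr.
have Vfree : row_free (map_mx (@tofrac {poly D}) V).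
  by rewrite /row_free eqn_leq rank_leq_row -{1}hr mxrankM_maxr.
have Ufree : row_free (map_mx (@tofrac {poly D}) U)^T.
  by rewrite /row_free eqn_leq rank_leq_row mxrank_tr -{1}hr mxrankM_maxl.
by rewrite mxrankMfree // -mxrank_tr trmx_mul mxrankMfree // mxrank_tr.
Qed.

Lemma prank_exp_stabilizes (D : idomainType) n (A : 'M[{poly D}]_n) :
  exists l, prank (A ^+ l) = prank (A ^+ l.+1).
Proof.
(* If the rank dropped at every step, [l = n.+1] would violate this bound. *)
apply: NNPP => h; suff H l : (prank (A ^+ l) + l <= n)%N by have := H n.+1; lia.
elim: l => [|l IH]; first by rewrite addn0 rank_leq_row.
suff : (prank (A ^+ l.+1) < prank (A ^+ l))%N by lia.
rewrite ltn_neqAle; apply/andP; split; first by apply/eqP => e; apply: h; exists l.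
by rewrite /prank exprS -mulmxE map_mxM mxrankM_maxr.
Qed.

Lemma prank_det_neq0 (D : idomainType) n (A : 'M[{poly D}]_n) :
  prank A = n -> \det A != 0.
Proof.
move=> h; have : row_free (map_mx (@tofrac {poly D}) A) by apply/eqP.
by rewrite row_free_unit unitmxE unitfE det_map_mx tofrac_eq0.
Qed.

Lemma sse_lag_nonsingular (D : idomainType) (hD : is_PID D) l n (A : 'M[{poly D}]_n) :
  prank (A ^+ l) = prank (A ^+ l.+1) ->
  exists (m : nat) (B : 'M[{poly D}]_m), \det B != 0 /\ sse_lag A B l.
Proof.
elim: l n A => [|l IH] n A hl.
  exists n, A; split; last exact: sse_lag0.
  (* For [l = 0], [hl] compares [A] with [A ^+ 0], the identity, of rank [n]. *)
  apply: prank_det_neq0; rewrite -[A]expr1 -hl expr0.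
  by rewrite /prank map_mx1 mxrank1.
have [U [V hA]] := rank_factorization hD A.
have hU k : prank ((V *m U) ^+ k) = prank (A ^+ k.+1).
  have -> : A ^+ k.+1 = U *m (V *m U) ^+ k *m V by rewrite -exprmx_mulC -hA.
  by rewrite prank_mul_inner // -hA.
have [|m [B [B0 hB]]] := IH _ (V *m U); first by rewrite !hU.
by exists m, B; split=> //; apply: sse_lagS hB; exists U, V.
Qed.

Theorem theorem1p1 (D : idomainType) (hD : is_PID D) (n : nat)
    (A : 'M[{poly D}]_n) (hA : ~ nilpotent_mx A) :
  (forall l : nat,
     prank (A ^+ l) = prank (A ^+ l.+1) ->
     (forall k : nat, (k < l)%N -> prank (A ^+ k) <> prank (A ^+ k.+1)) ->
     exists (m : nat) (B : 'M[{poly D}]_m), \det B != 0 /\ sse_lag A B l)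
  /\ (exists (m : nat) (B : 'M[{poly D}]_m), \det B != 0 /\ sse A B).
Proof.
split; first by move=> l hl _; apply: sse_lag_nonsingular.
have [l /(sse_lag_nonsingular hD) [m [B [B0 hB]]]] := prank_exp_stabilizes A.
by exists m, B; split=> //; exists l.
Qed.
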